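(* For all $k\geq2$, the DCell $D_{k,2}$ is super-$\lambda_3$: every minimum $3$-restricted edge-cut $F$ of $D_{k,2}$ is such that $D_{k,2}-F$ has a component that is a connected subgraph on exactly three vertices.
   Context: DCell $D_{k,n}$ ($n\geq 2$, $k\geq 0$) is defined recursively. $D_{0,n}$ is the complete graph $K_n$ on vertices $0,1,\dots,n-1$. Let $t_{k,n}=|V(D_{k,n})|$. For $k\geq1$, $D_{k,n}$ is built from $t_{k-1,n}+1$ disjoint copies $D^0_{k-1,n},\dots,D^{t_{k-1,n}}_{k-1,n}$ of $D_{k-1,n}$; a vertex of copy $D^i_{k-1,n}$ is labeled $(i,a_{k-1},\dots,a_0)$, where $(a_{k-1},\dots,a_0)$ is its label in $D_{k-1,n}$, and its index within the copy is $uid_{k-1}=a_0+\sum_{l=1}^{k-1}a_l t_{l-1,n}$. For each pair $a<b$ of copy indices, one edge joins the vertex of $D^a_{k-1,n}$ with $uid_{k-1}=b-1$ to the vertex of $D^b_{k-1,n}$ with $uid_{k-1}=a$. An edge set $F$ is an $m$-restricted edge-cut of $G$ if $G-F$ is disconnected and every component has at least $m$ vertices; $G$ is super-$\lambda_m$ if every minimum $m$-restricted edge-cut isolates a connected subgraph on exactly $m$ vertices. *)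

(* Defs.v *)
From HB Require Import structures.
From mathcomp Require Import all_boot.

Set Implicit Arguments.
Unset Strict Implicit.
Unset Printing Implicit Defensive.

(* A finite simple graph on T is a symmetric irreflexive relation on T; its
   edges are the corresponding two-element sets of vertices. *)
Section Graphs.
Variables (T : finType) (e : rel T).

Definition edges : {set {set T}} :=
  [set [set p.1; p.2] | p : T * T & e p.1 p.2].

Definition remove_edges (F : {set {set T}}) : rel T :=
  [rel x y | e x y && ([set x; y] \notin F)].

Definition component (x : T) : {set T} := [set y | connect e x y].

Definition components : {set {set T}} := [set component x | x : T].

Definition connected : bool := [forall x, forall y, connect e x y].

End Graphs.

Section RestrictedEdgeCuts.
Variables (T : finType) (e : rel T) (m : nat).

Definition restricted_edge_cut (F : {set {set T}}) : bool :=
  [&& F \subset edges e,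
      ~~ connected (remove_edges e F)
    & [forall C in components (remove_edges e F), m <= #|C|]].

Definition minimum_restricted_edge_cut (F : {set {set T}}) : Prop :=
  restricted_edge_cut F /\
  forall F' : {set {set T}}, restricted_edge_cut F' -> #|F| <= #|F'|.

Definition super_lambda : Prop :=
  forall F : {set {set T}}, minimum_restricted_edge_cut F ->
  exists2 C, C \in components (remove_edges e F) & #|C| = m.

End RestrictedEdgeCuts.

(* The label (a_k, a_(k-1), ..., a_0) is encoded as the pair of the copy index
   a_k and the label (a_(k-1), ..., a_0) inside that copy. *)
Fixpoint dcell_vertex (n k : nat) : finType :=
  match k with
  | 0 => 'I_n
  | k'.+1 => ('I_#|dcell_vertex n k'|.+1 * dcell_vertex n k')%type
  end.

Definition dcell_order (n k : nat) : nat := #|dcell_vertex n k|.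

(* uid (a_k, ..., a_0) = a_0 + \sum_(1 <= l <= k) a_l * t_(l-1) *)
Fixpoint dcell_uid (n k : nat) : dcell_vertex n k -> nat :=
  match k with
  | 0 => fun a : 'I_n => a : nat
  | k'.+1 => fun x : 'I_(dcell_order n k').+1 * dcell_vertex n k' =>
      dcell_uid x.2 + x.1 * dcell_order n k'
  end.

(* For a < b, x in copy a and y in copy b. *)
Definition dcell_link (n k : nat)
    (x y : 'I_(dcell_order n k).+1 * dcell_vertex n k) : bool :=
  [&& x.1 < y.1, dcell_uid x.2 == y.1.-1 & dcell_uid y.2 == x.1 :> nat].

Fixpoint dcell_adj (n k : nat) : rel (dcell_vertex n k) :=
  match k with
  | 0 => fun a b : 'I_n => a != b
  | k'.+1 => fun x y : 'I_(dcell_order n k').+1 * dcell_vertex n k' =>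
      [|| (x.1 == y.1) && dcell_adj x.2 y.2, dcell_link x y | dcell_link y x]
  end.

Lemma dcell_adj_sym n k : symmetric (@dcell_adj n k).
Proof.
elim: k => [|k IHk] x y /=; first by rewrite eq_sym.
by rewrite eq_sym IHk [dcell_link x y || _]orbC.
Qed.

Lemma dcell_adj_irrefl n k : irreflexive (@dcell_adj n k).
Proof.
by elim: k => [|k IHk] x /=; rewrite ?eqxx // IHk /dcell_link ltnn.
Qed.

(* Main.v *)
(* Let t be the order of D_(k-1,2) and let S be a vertex set of D_(k,2) with
   3 < |S| < |V| - 3; the point is that at least 3k edges leave S.  Call a copy
   of D_(k-1,2) full, empty or partial according to its intersection with S.
   If some copy is full and some copy is empty, the links between full and empty
   copies together with the k edges cut inside each partial copy give at least t
   edges, and t >= 3k once k >= 2.  Otherwise, up to complement, no copy is full,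
   and with p partial copies at least |S| - p(p - 1) vertices of S are linked to
   an empty copy; with the k edges cut in each partial copy this suffices for
   p >= 3, and the cases p = 1, 2 follow by induction from the bounds for smaller
   sets.  On the other hand a path on three vertices has at most 3k - 1 leaving
   edges, and these form a 3-restricted edge-cut: a component with at most two
   vertices could be merged into the path, giving a set of 4 or 5 vertices with
   at most 3k - 1 leaving edges.  So a minimum 3-restricted edge-cut has fewer
   than 3k edges, and its components cannot all have at least four vertices. *)
Require Import Defs.
From mathcomp Require Import all_boot.
From mathcomp Require Import zify.

Set Implicit Arguments.
Unset Strict Implicit.
Unset Printing Implicit Defensive.

(** * Cut sizes and slices *)

(* Each edge between S and its complement is counted once, oriented out of S. *)
Definition cut_size (T : finType) (e : rel T) (S : {set T}) : nat :=
  \sum_x \sum_y [&& x \in S, y \notin S & e x y].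

Lemma cut_sizeC (T : finType) (e : rel T) (S : {set T}) :
  symmetric e -> cut_size e (~: S) = cut_size e S.
Proof.
move=> e_sym; rewrite /cut_size exchange_big /=.
apply: eq_bigr => x _; apply: eq_bigr => y _.
by rewrite !inE negbK e_sym andbCA.
Qed.

Lemma cut_size_card (T : finType) (e : rel T) (S : {set T}) :
  cut_size e S = #|[set p | [&& p.1 \in S, p.2 \notin S & e p.1 p.2]]|.
Proof.
rewrite /cut_size pair_bigA /= -sum1dep_card [RHS]big_mkcond /=.
by apply: eq_bigr => -[x y] _ /=; case: ifP.
Qed.

Lemma sum_prod (I T : finType) (F : I * T -> nat) :
  \sum_p F p = \sum_i \sum_x F (i, x).
Proof. by rewrite pair_bigA; apply: eq_bigr => -[]. Qed.

Definition slice (I T : finType) (S : {set I * T}) (i : I) : {set T} :=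
  [set x | (i, x) \in S].

(* k + 1, 2k and 3k - 1 are the numbers of edges leaving a path on 1, 2 and 3
   vertices of a (k+1)-regular graph. *)
Definition cut_bound (k N s c : nat) : Prop :=
  [/\ 0 < s -> s < N -> k < c,
      1 < s -> s + 1 < N -> 2 * k <= c,
      2 < s -> s + 2 < N -> 3 * k <= c.+1
    & 3 < s -> s + 3 < N -> 3 * k <= c].

(** * Cuts in a graph made of linked copies *)

(* u i j is the vertex of copy i that is linked to copy j; u i i is junk. *)
Section Copies.
Variables (T I : finType) (e : rel T) (E : rel (I * T)) (u : I -> I -> T).
Hypothesis card_I : #|I| = #|T|.+1.
Hypothesis u_inj : forall i, {in predC1 i &, injective (u i)}.
Hypothesis E_copy : forall i x y, e x y -> E (i, x) (i, y).
Hypothesis E_link : forall i j, i != j -> E (i, u i j) (j, u j i).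
Variable S : {set I * T}.

Local Notation slice := (slice S).
Let partial : {set I} := [set i | (slice i != set0) && (slice i != setT)].

Let crossing :=
  \sum_i \sum_(j | j != i) (((i, u i j) \in S) && ((j, u j i) \notin S) : nat).

Lemma sum_slice : \sum_i #|slice i| = #|S|.
Proof.
rewrite -[RHS]sum1_card [RHS]big_mkcond /= sum_prod.
by apply: eq_bigr => i _; rewrite -big_mkcond -sum1dep_card.
Qed.

Lemma cut_size_copies :
  \sum_i cut_size e (slice i) + crossing <= cut_size E S.
Proof.
have -> : cut_size E S = \sum_i \sum_j \sum_x \sum_y
    [&& (i, x) \in S, (j, y) \notin S & E (i, x) (j, y)].
  rewrite /cut_size sum_prod; apply: eq_bigr => i _.
  rewrite [RHS]exchange_big /=; apply: eq_bigr => x _.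
  exact: sum_prod.
rewrite /crossing -big_split /=; apply: leq_sum => i _.
rewrite [X in _ <= X](bigD1 i) //=; apply: leq_add.
  apply: leq_sum => x _; apply: leq_sum => y _; rewrite !inE.
  by case exy: (e x y); rewrite ?andbF // (E_copy _ exy).
apply: leq_sum => j ji.
rewrite (bigD1 (u i j)) //= (bigD1 (u j i)) //= E_link 1?eq_sym // andbT.
by rewrite -addnA leq_addr.
Qed.

Lemma crossing_full_empty :
  #|[set i | slice i == setT]| * #|[set i | slice i == set0]| <= crossing.
Proof.
rewrite -sum_nat_const big_mkcond /=; apply: leq_sum => i _.
case: ifP => //; rewrite inE => /eqP iT.
rewrite -sum1_card big_mkcond [X in _ <= X]big_mkcond /=; apply: leq_sum => j _.
case: ifP => //; rewrite inE => /eqP j0.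
have inS x : (i, x) \in S by have := in_setT x; rewrite -iT inE.
have notS x : (j, x) \notin S by have := in_set0 x; rewrite -j0 inE => ->.
(* The junk vertex [u i i] shows that [T] is inhabited, so no copy is both full and empty. *)
by rewrite inS notS; case: eqP => // ji; move: (notS (u i i)); rewrite ji inS.
Qed.

(** [u i] injects the [#|T|] other indices into [T], so it is onto: every vertex of copy [i] carries
    a link. *)
Lemma card_slice_links i :
  #|slice i| <= \sum_(j | j != i) ((i, u i j) \in S).
Proof.
have im_u : u i @: predC1 i = setT.
  apply/eqP; rewrite eqEcard subsetT /= card_in_imset; last exact: u_inj.
  by rewrite cardsT cardC1 card_I.
have sub : slice i \subset u i @: [set j | (j != i) && ((i, u i j) \in S)].
  apply/subsetP => x; rewrite inE => xS.
  have : x \in u i @: predC1 i by rewrite im_u.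
  case/imsetP => j ji xE; apply/imsetP; exists j => //.
  by rewrite inE -xE xS andbT.
apply: leq_trans (subset_leq_card sub) _.
apply: leq_trans (leq_imset_card _ _) _.
by rewrite -sum1dep_card big_mkcondr; apply: leq_sum => j _; case: ifP.
Qed.

(** Of the links at a copy in [M], [#|M|.-1] lead to copies in [M]; any other leads to an empty copy
    and crosses if it starts in [S]. *)
Lemma crossing_sparse (M : {set I}) :
  (forall i, i \notin M -> slice i = set0) ->
  #|S| <= crossing + #|M| * #|M|.-1.
Proof.
move=> M0.
rewrite -sum_slice (bigID (mem M)) /= [X in _ + X]big1; last first.
  by move=> i /M0 ->; rewrite cards0.
rewrite addn0 /crossing [X in _ <= X + _](bigID (mem M)) /= addnAC.
apply: leq_trans (leq_addr _ _).
rewrite -sum_nat_const -big_split /=; apply: leq_sum => i iM.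
apply: leq_trans (card_slice_links i) _.
have -> : #|M|.-1 = \sum_(j | j != i) (j \in M).
  rewrite (cardsD1 i M) iM -sum1_card big_mkcond [RHS]big_mkcond /=.
  by apply: eq_bigr => j _; rewrite !inE; case: (j != i); case: (j \in M).
rewrite -big_split /=; apply: leq_sum => j _.
case jM: (j \in M); first by case: (_ \in S); case: (_ \in S).
suff -> : (j, u j i) \notin S by rewrite andbT addn0.
by have := in_set0 (u j i); rewrite -(M0 j) ?jM // inE => ->.
Qed.

Lemma card_copies : 0 < #|T| ->
  #|[set i | slice i == setT]| + #|[set i | slice i == set0]| + #|partial|
    = #|T|.+1.
Proof.
move=> T0; rewrite -card_I -cardsT -addnA.
rewrite -(cardsID [set i | slice i == setT] setT) setTI; congr (_ + _).
rewrite -(cardsID [set i | slice i == set0] (_ :\: _)); congr (_ + _).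
  apply: eq_card => i; rewrite !inE andbT.
  case: eqP => [->|]; last by rewrite andbF.
  rewrite andbT; apply/esym/eqP => H; move: T0.
  by rewrite -cardsT -H cards0.
by apply: eq_card => i; rewrite !inE andbT.
Qed.

Lemma sum_cut_size_partial (P : {set I}) :
  \sum_(i in P) cut_size e (slice i) + crossing <= cut_size E S.
Proof.
apply: leq_trans cut_size_copies; rewrite leq_add2r.
by rewrite [X in _ <= X](bigID (mem P)) leq_addr.
Qed.

Variable k : nat.
Hypothesis cut_bound_e : forall X : {set T}, cut_bound k #|T| #|X| (cut_size e X).
Hypothesis card_T : if k is 0 then #|T| == 2 else 3 * k.+1 <= #|T|.

Lemma slice_partial i : i \in partial -> 0 < #|slice i| < #|T|.
Proof.
rewrite inE => /andP[i0 iT]; rewrite card_gt0 i0 -cardsT.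
by apply: proper_card; rewrite properE subsetT subTset.
Qed.

Lemma cut_size_partial i : i \in partial -> k < cut_size e (slice i).
Proof.
by case: (cut_bound_e (slice i)) => H _ _ _ /slice_partial/andP[]; apply: H.
Qed.

Lemma partial_crossing : #|partial| * k.+1 + crossing <= cut_size E S.
Proof.
apply: leq_trans (sum_cut_size_partial partial); rewrite leq_add2r.
by rewrite -sum_nat_const; apply: leq_sum => i; apply: cut_size_partial.
Qed.

Lemma cut_size_mixed i j : slice i = setT -> slice j = set0 ->
  #|T| <= cut_size E S.
Proof.
move=> iT j0.
have : 0 < #|T| by case: (k) card_T => [/eqP->|n] //; lia.
move=> /card_copies.
have : 0 < #|[set i | slice i == setT]|.
  by rewrite card_gt0; apply/set0Pn; exists i; rewrite inE iT.
have : 0 < #|[set i | slice i == set0]|.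
  by rewrite card_gt0; apply/set0Pn; exists j; rewrite inE j0.
(* For f full, g empty and p partial copies, f g >= f + g - 1 = [#|T|] - p, and the partial copies
   cut at least p more edges. *)
by move: partial_crossing crossing_full_empty; nia.
Qed.

Lemma cut_bound_sparse : (forall i, slice i != setT) ->
  cut_bound k.+1 (#|T|.+1 * #|T|) #|S| (cut_size E S).
Proof.
move=> notT.
have M0 i : i \notin partial -> slice i = set0.
  by rewrite inE notT andbT negbK => /eqP.
have := partial_crossing; have := crossing_sparse M0.
have sumS : #|S| = \sum_(i in partial) #|slice i|.
  rewrite -sum_slice (bigID (mem partial)) /= [X in _ + X]big1 ?addn0 //.
  by move=> i /M0 ->; rewrite cards0.
have := sum_cut_size_partial partial.
rewrite /cut_bound; case: (ltngtP #|partial| 2) => [|p3|/eqP/cards2P[i [j [ij pE]]]].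
(* At most one partial copy: every vertex of [S] is linked to an empty copy, so [#|S|] adds to the
   cut inside the copy. *)
- rewrite ltnS leq_eqVlt ltnS leqn0 => /orP[/cards1P[i pE]|/eqP/cards0_eq pE].
    have /slice_partial : i \in partial by rewrite pE set11.
    rewrite sumS pE !big_set1 cards1.
    case: (cut_bound_e (slice i)).
    by case: (k) card_T => [/eqP-> |n]; split; lia.
  by rewrite sumS pE !big_set0 cards0 => _ _ _; split.
- move=> _ _ le_c.
  have : 3 * k.+1 <= #|partial| * k.+1 by rewrite leq_mul2r p3 orbT.
  by split=> _ _; lia.
(* Two partial copies: a single link joins them, so at least [#|S| - 2] links cross, on top of the
   cuts inside both copies. *)
have iP : i \in partial by rewrite pE !inE eqxx.
have jP : j \in partial by rewrite pE !inE eqxx orbT.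
have := slice_partial iP; have := slice_partial jP.
rewrite sumS pE !big_setU1 ?inE // !big_set1 cards2 ij /=.
case: (cut_bound_e (slice i)) (cut_bound_e (slice j)).
move=> i1 i2 i3 i4 [j1 j2 j3 j4].
by case: (k) i1 i2 i3 i4 j1 j2 j3 j4 card_T => [|n] ? ? ? ? ? ? ? ?;
  [move/eqP->|]; split; lia.
Qed.

End Copies.

(** The side conditions of [cut_bound] are invariant under exchanging [s] and [N - s]. *)
Lemma cut_boundC (k N s c : nat) :
  s <= N -> cut_bound k N (N - s) c -> cut_bound k N s c.
Proof. by move=> sN [? ? ? ?]; split; lia. Qed.

Lemma slice_setC (I T : finType) (S : {set I * T}) (i : I) :
  slice (~: S) i = ~: slice S i.
Proof. by apply/setP => x; rewrite !inE. Qed.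

Lemma cut_bound_copies (T I : finType) (e : rel T) (E : rel (I * T))
    (u : I -> I -> T) (k : nat) :
  symmetric E ->
  #|I| = #|T|.+1 -> (forall i, {in predC1 i &, injective (u i)}) ->
  (forall i x y, e x y -> E (i, x) (i, y)) ->
  (forall i j, i != j -> E (i, u i j) (j, u j i)) ->
  (if k is 0 then #|T| == 2 else 3 * k.+1 <= #|T|) ->
  (forall X : {set T}, cut_bound k #|T| #|X| (cut_size e X)) ->
  forall S : {set I * T}, cut_bound k.+1 #|{: I * T}| #|S| (cut_size E S).
Proof.
move=> E_sym card_I u_inj E_copy E_link card_T bound_e S.
have sparse (X : {set I * T}) : (forall i, slice X i != setT) ->
    cut_bound k.+1 (#|T|.+1 * #|T|) #|X| (cut_size E X).
  exact: (cut_bound_sparse card_I u_inj E_copy E_link).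
rewrite card_prod card_I.
case: (pickP (fun i => slice S i == setT)) => [i /eqP iT|noT]; last first.
  by apply: sparse => i; rewrite noT.
case: (pickP (fun i => slice S i == set0)) => [j /eqP j0|no0]; last first.
  apply: cut_boundC.
    by rewrite -card_I -card_prod; apply: max_card.
  have -> : #|T|.+1 * #|T| - #|S| = #|~: S|.
    by rewrite [RHS]cardsCs setCK card_prod card_I.
  rewrite -(cut_sizeC S E_sym).
  by apply: sparse => l; rewrite slice_setC -setC0 (inj_eq (@setC_inj T)) no0.
have : #|T| <= cut_size E S.
  exact: (cut_size_mixed card_I E_copy E_link bound_e card_T iT j0).
(* For positive [k], [T] has at least 3(k + 1) elements, enough for every clause; for [k = 0] it has
   2, and the last clause is vacuous on six vertices. *)
by case: (k) card_T => [/eqP->|n] *; split; lia.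
Qed.

(** * DCell as a graph of linked copies *)

Lemma dcell_order_succ n k :
  dcell_order n k.+1 = (dcell_order n k).+1 * dcell_order n k.
Proof. by rewrite /dcell_order /= card_prod card_ord. Qed.

Lemma dcell_uid_lt n k (x : dcell_vertex n k) : dcell_uid x < dcell_order n k.
Proof.
elim: k x => [|k IHk] x; first by rewrite /dcell_order card_ord ltn_ord.
case: x => [i x]; rewrite dcell_order_succ /=.
by rewrite mulSn -addSn leq_add ?IHk // leq_mul2r -ltnS ltn_ord orbT.
Qed.

Lemma dcell_uid_inj n k : injective (@dcell_uid n k).
Proof.
elim: k => [|k IHk] x y /=; first exact: val_inj.
case: x y => [i x] [j y] /= eq_uid.
have lt_x := dcell_uid_lt x; have lt_y := dcell_uid_lt y.
have t_gt0 : 0 < dcell_order n k by apply: leq_ltn_trans lt_x.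
have ij : i = j.
  apply: val_inj; have := congr1 (divn^~ (dcell_order n k)) eq_uid.
  by rewrite !(addnC (dcell_uid _)) !divnMDl // !divn_small // !addn0.
by move: eq_uid; rewrite ij => /addIn/IHk ->.
Qed.

Lemma dcell_uid_surj n k m :
  m < dcell_order n k -> exists x : dcell_vertex n k, dcell_uid x = m.
Proof.
move=> lt_m; pose f (x : dcell_vertex n k) := Ordinal (dcell_uid_lt x).
have f_inj : injective f by move=> x y [/dcell_uid_inj].
have : Ordinal lt_m \in codom f.
  by rewrite (inj_card_onto f_inj) ?card_ord.
by case/codomP => x [->]; exists x.
Qed.

(** [unbump i j] is [j - 1] for [i < j] and [j] for [j < i]: the uid, within copy [i], of the end of
    its link to copy [j]. *)
Lemma dcell_ports n k : 0 < dcell_order n k ->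
  exists u : 'I_(dcell_order n k).+1 -> 'I_(dcell_order n k).+1 ->
             dcell_vertex n k,
  forall i j, i != j -> dcell_uid (u i j) = unbump i j.
Proof.
case/card_gt0P => x0 _.
exists (fun i j => odflt x0 [pick x | dcell_uid x == unbump i j]) => i j ij.
case: pickP => [x /eqP //|no_x].
have [|x uid_x] := @dcell_uid_surj n k (unbump i j).
  have := ltn_ord i; have := ltn_ord j; move: ij; rewrite -val_eqE /= /unbump.
  by lia.
by have := no_x x; rewrite uid_x eqxx.
Qed.

Lemma dcell_order2_ge k :
  if k is 0 then dcell_order 2 k == 2 else 3 * k.+1 <= dcell_order 2 k.
Proof.
case: k => [|k]; first by rewrite /dcell_order card_ord.
elim: k => [|k IHk]; first by rewrite dcell_order_succ /dcell_order card_ord.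
by rewrite dcell_order_succ; nia.
Qed.

Lemma dcell_cut_bound k (S : {set dcell_vertex 2 k}) :
  cut_bound k (dcell_order 2 k) #|S| (cut_size (@dcell_adj 2 k) S).
Proof.
elim: k S => [|k IHk] S.
  (* In K_2 only the first clause has content. *)
  rewrite /dcell_order card_ord; split; try lia.
  move=> S_gt0 S_lt2; rewrite cut_size_card card_gt0.
  case/card_gt0P: S_gt0 => x xS.
  have /card_gt0P[y] : 0 < #|~: S| by rewrite cardsCs setCK card_ord subn_gt0.
  rewrite inE => yS; apply/set0Pn; exists (x, y); rewrite inE /= xS yS /=.
  by apply: contraNneq yS => <-.
have t_gt0 : 0 < dcell_order 2 k.
  by have := dcell_order2_ge k; case: (k) => [/eqP->|n]; lia.
have [u uidE] := dcell_ports t_gt0.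
apply: (cut_bound_copies (e := @dcell_adj 2 k) (E := @dcell_adj 2 k.+1) (u := u)).
- exact: (@dcell_adj_sym 2 k.+1).
- by rewrite card_ord.
- move=> i j l; rewrite !inE => ji li eq_u; apply: ord_inj.
  apply: (can_in_inj (@unbumpK i)); rewrite ?inE //.
  by rewrite -!uidE 1?eq_sym // eq_u.
- by move=> i x y /= xy; rewrite eqxx xy.
- move=> i j ij; have ji : j != i by rewrite eq_sym.
  rewrite /= /dcell_link /= (negPf ij) /= !uidE //.
  move: ij; rewrite -val_eqE /= /unbump.
  by case: ltngtP => //= ij _; rewrite ?subn0 ?subn1 ?eqxx.
- exact: (dcell_order2_ge k).
exact: IHk.
Qed.

Lemma dcell_degree n k (x : dcell_vertex n k) :
  #|[set y | dcell_adj x y]| <= k + n.-1.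
Proof.
elim: k x => [|k IHk] x /=.
  rewrite add0n -[n in n.-1]card_ord -(cardC1 x) subset_leq_card //.
  by apply/subsetP => y; rewrite !inE eq_sym.
(* Let [x] have uid m in copy i. A partner in a higher copy forces m >= i, one in a lower copy m <
   i; in either case m fixes its copy and i its uid. *)
have link_uniq : #|[set y | dcell_link x y || dcell_link y x]| <= 1.
  apply/card_le1_eqP => -[j y] [l z]; rewrite !inE /dcell_link /= => Hy Hz.
  have jl : j = l by apply: val_inj => /=; lia.
  by rewrite jl; congr (_, _); apply: dcell_uid_inj; lia.
apply: leq_trans (_ : #|[set (x.1, y) | y in [set y | dcell_adj x.2 y]] :|:
  [set y | dcell_link x y || dcell_link y x]| <= _).
  apply/subset_leq_card/subsetP => -[j y]; rewrite !inE => /orP[|->]; last first.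
    by rewrite orbT.
  case/andP => /= /eqP <- xy; apply/orP; left; apply/imsetP; exists y => //.
  by rewrite inE.
apply: leq_trans (leq_card_setU _ _) _.
rewrite [k.+1 + _]addSn -[_.+1 in X in _ <= X]addn1 leq_add //.
exact: leq_trans (leq_imset_card _ _) (IHk _).
Qed.

(** * Edge sets, components and cuts *)

Section EdgeCuts.
Variables (T : finType) (e : rel T).
Hypothesis e_sym : symmetric e.

Lemma remove_edges_sym (F : {set {set T}}) : symmetric (remove_edges e F).
Proof. by move=> x y; rewrite /remove_edges /= e_sym setUC. Qed.

(** Every edge leaving a component lies in [F], and only one of its orientations points outwards, so
    no edge is counted twice. *)
Lemma cut_size_component (F : {set {set T}}) (x0 : T) :
  cut_size e (component (remove_edges e F) x0) <= #|F|.
Proof.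
set C := component _ x0; rewrite cut_size_card.
set D := [set p | _]; pose f (p : T * T) := [set p.1; p.2].
rewrite -(card_in_imset (f := f) (D := D)).
  apply/subset_leq_card/subsetP => _ /imsetP[[x y] + ->].
  rewrite inE /= => /and3P[xC yC xy]; apply: contraNT yC => xyF.
  move: xC; rewrite !inE => /connect_trans; apply.
  by apply: connect1; rewrite /remove_edges /= xy.
move=> [x y] [z w]; rewrite ![_ \in D]inE /= => /and3P[xC yC _] /and3P[zC wC _] eq_xy.
have xz : x = z.
  have : x \in [set z; w] by rewrite -[[set z; w]]eq_xy set21.
  by rewrite !inE => /orP[/eqP //|/eqP xw]; rewrite -xw xC in wC.
have yw : y = w.
  have : y \in [set z; w] by rewrite -[[set z; w]]eq_xy set22.
  by rewrite !inE => /orP[/eqP yz|/eqP //]; rewrite yz zC in yC.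
by rewrite xz yw.
Qed.

Definition cut_edges (P : {set T}) : {set {set T}} :=
  [set [set p.1; p.2] | p : T * T & [&& p.1 \in P, p.2 \notin P & e p.1 p.2]].

Lemma card_cut_edges (P : {set T}) : #|cut_edges P| <= cut_size e P.
Proof.
rewrite cut_size_card; apply: leq_trans (leq_imset_card _ _) _.
by apply/subset_leq_card/subsetP => p; rewrite !inE.
Qed.

Lemma cut_edgesP (P : {set T}) (x y : T) :
  e x y -> ([set x; y] \in cut_edges P) = ((x \in P) != (y \in P)).
Proof.
move=> xy; apply/imsetP/idP => [[[a b]]|].
  rewrite inE /= => /and3P[aP bP _] eq_xy.
  have : a \in [set x; y] by rewrite eq_xy set21.
  have : b \in [set x; y] by rewrite eq_xy set22.
  rewrite !inE => /orP[] /eqP bE /orP[] /eqP aE; subst;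
    by rewrite ?aP ?(negPf bP) //; rewrite aP in bP.
case: (boolP (x \in P)) (boolP (y \in P)) => xP [] yP // _.
  by exists (x, y); rewrite // inE /= xP yP.
by exists (y, x); rewrite 1?setUC // inE /= yP xP e_sym.
Qed.

Lemma cut_edges_component (P : {set T}) (x y : T) :
  y \in component (remove_edges e (cut_edges P)) x -> (x \in P) = (y \in P).
Proof.
rewrite inE => /connectP[p + ->]; elim: p x => //= z p IHp x.
by rewrite /remove_edges /= -andbA => /and3P[xz]; rewrite cut_edgesP // negbK => /eqP-> /IHp.
Qed.

(** An edge from the component to a vertex outside [P] is not removed, so it stays in the component;
    edges leaving the union therefore start in [P]. *)
Lemma cut_sizeU_component (P : {set T}) (x : T) : x \notin P ->
  cut_size e (P :|: component (remove_edges e (cut_edges P)) x)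
    <= cut_size e P.
Proof.
move=> xP; rewrite /cut_size; apply: leq_sum => y _; apply: leq_sum => z _.
rewrite !inE negb_or.
case: (boolP (y \in P)) => /= yP; first by case: (z \in P); case: connect.
case: (boolP (z \in P)) => //= zP; first by rewrite andbF.
case xy: connect => //=; case yz: (e y z); rewrite ?andbF // andbT.
suff -> : connect (remove_edges e (cut_edges P)) x z by [].
apply: connect_trans xy (connect1 _).
by rewrite /remove_edges /= yz cut_edgesP // (negPf yP) (negPf zP).
Qed.

(** The two path edges use up one unit of degree at [a] and at [c] and two at the middle vertex [b],
    four in all. *)
Lemma cut_size_path (d : nat) (a b c : T) :
  (forall x, #|[set y | e x y]| <= d) ->
  e b a -> e b c -> uniq [:: a; b; c] ->
  cut_size e [set a; b; c] + 4 <= 3 * d.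
Proof.
move=> deg ba bc; rewrite /= !inE negb_or !andbT => /andP[/andP[ab ac] bc'].
set P := [set a; b; c].
pose w x := \sum_y [&& x \in P, y \notin P & e x y].
have out x (Q : {set T}) : Q \subset P -> (forall y, y \in Q -> e x y) ->
    w x + #|Q| <= d.
  move=> /subsetP QP eQ; apply: leq_trans (deg x).
  rewrite -!sum1_card [X in _ + X]big_mkcond [X in _ <= X]big_mkcond -big_split /=.
  apply: leq_sum => y _; rewrite inE; case: (boolP (y \in Q)) => [yQ|_].
    by rewrite (QP _ yQ) andbF eQ.
  by rewrite addn0; case: (x \in P) (y \notin P) (e x y) => -[] [].
have outa : w a + 1 <= d.
  rewrite -(cards1 b); apply: out => [|y]; first by rewrite sub1set !inE eqxx orbT.
  by rewrite inE => /eqP->; rewrite e_sym.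
have outc : w c + 1 <= d.
  rewrite -(cards1 b); apply: out => [|y]; first by rewrite sub1set !inE eqxx orbT.
  by rewrite inE => /eqP->; rewrite e_sym.
have outb : w b + 2 <= d.
  have <- : #|[set a; c]| = 2 by rewrite cards2 ac.
  apply: out => [|y]; last by rewrite !inE => /orP[] /eqP->.
  by apply/subsetP => y; rewrite !inE => /orP[] ->; rewrite ?orbT.
suff -> : cut_size e P = w a + (w b + w c) by lia.
transitivity (\sum_x w x) => //.
rewrite (bigD1 a) //= (bigD1 b) 1?eq_sym //= (bigD1 c) /=; last first.
  by rewrite ![c == _]eq_sym ac.
rewrite big1 ?addn0 // => x /andP[/andP[xa xb] xc].
by rewrite /w big1 // => y _; rewrite !inE (negPf xa) (negPf xb) (negPf xc).
Qed.

End EdgeCuts.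

(** * Minimum 3-restricted edge-cuts of the DCell *)

Theorem theorem14 (k : nat) (hk : 2 <= k) : super_lambda (@dcell_adj 2 k) 3.
Proof.
set e := @dcell_adj 2 k.
have e_sym : symmetric e by apply: dcell_adj_sym.
have bound := @dcell_cut_bound k; rewrite -/e in bound.
(* 8 = 5 + 3: [cut4] will be applied to sets of up to five vertices. *)
have N_ge : 8 < dcell_order 2 k.
  by have := dcell_order2_ge k; case: (k) hk => [|n] //; lia.
have cut4 (S : {set dcell_vertex 2 k}) :
    3 < #|S| -> #|S| + 3 < dcell_order 2 k -> 3 * k <= cut_size e S.
  by case: (bound S).
have [b _] : exists b, b \in dcell_vertex 2 k.
  by apply/card_gt0P; rewrite -/(dcell_order 2 k); lia.
(* More than [k] edges leave [[set b]], so [b] is the middle of a path on three vertices. *)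
have : 1 < #|[set y | e b y]|.
  have [+ _ _ _] := bound [set b]; rewrite cards1 => /(_ isT) lt_cut.
  have {}lt_cut : k < cut_size e [set b] by apply: lt_cut; lia.
  apply: leq_trans (_ : cut_size e [set b] <= _); first by lia.
  rewrite cut_size_card -(card_in_imset (f := pair b) (D := [set y | e b y])); last first.
    by move=> ? ? _ _ [].
  apply/subset_leq_card/subsetP => -[x y]; rewrite !inE /= => /and3P[/eqP-> _ by_].
  by apply/imsetP; exists y; rewrite ?inE.
case/card_gt1P => a [c [+ + ac]]; rewrite !inE => ba bc.
have abc : uniq [:: a; b; c].
  rewrite /= !inE negb_or ac !andbT; apply/andP; split.
    by apply: contraTneq ba => ->; rewrite /e dcell_adj_irrefl.
  by apply: contraTneq bc => ->; rewrite /e dcell_adj_irrefl.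
have := cut_size_path e_sym (@dcell_degree 2 k) ba bc abc.
set P := [set a; b; c] => cutP.
have cardP : #|P| = 3.
  have -> : P = [set:: [:: a; b; c]] by apply/setP => x; rewrite !inE orbA.
  by rewrite cardsE; apply/card_uniqP.
have P_cut : restricted_edge_cut e 3 (cut_edges e P).
  apply/and3P; split.
  - apply/subsetP => _ /imsetP[p + ->]; rewrite inE => /and3P[_ _ ep].
    by apply/imsetP; exists p; rewrite ?inE.
  - have /subsetPn[x _ xP] : ~~ ([set: dcell_vertex 2 k] \subset P).
      apply/negP => /subset_leq_card; rewrite cardsT cardP.
      by rewrite -/(dcell_order 2 k); lia.
    apply/negP => /forallP/(_ a)/forallP/(_ x) ax.
    have := @cut_edges_component _ _ e_sym P a x; rewrite inE => /(_ ax).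
    by rewrite (negPf xP) !inE eqxx.
  apply/forall_inP => _ /imsetP[x _ ->].
  set C := component _ x.
  have xC : x \in C by rewrite inE.
  (* The path edges survive, so a component meeting [P] contains it. *)
  case: (boolP (x \in P)) => xP.
    rewrite -cardP; apply/subset_leq_card/subsetP => y yP.
    have conn_b z : z \in P -> connect (remove_edges e (cut_edges e P)) b z.
      rewrite /P -!setUA !inE => /or3P[] /eqP-> //; apply: connect1; rewrite /remove_edges /=.
        by rewrite ba cut_edgesP // !inE !eqxx ?orbT.
      by rewrite bc cut_edgesP // !inE !eqxx ?orbT.
    rewrite inE (connect_trans _ (conn_b _ yP)) //.
    by rewrite (sym_connect_sym (remove_edges_sym e_sym _)) conn_b.
  rewrite leqNgt; apply/negP => C_lt3.
  have : #|P :|: C| = 3 + #|C|.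
    rewrite cardsU cardP; suff -> : P :&: C = set0 by rewrite cards0 subn0.
    apply/setP => y; rewrite in_setI in_set0; apply/negP => /andP[yP xy].
    by have := cut_edges_component e_sym xy; rewrite yP (negPf xP).
  have C_gt0 : 0 < #|C| by apply/card_gt0P; exists x.
  have := cut4 (P :|: C); have := cut_sizeU_component e_sym xP.
  by rewrite -/C; lia.
move=> F [F_cut F_min].
have F_le : #|F| < 3 * k.
  by have := F_min _ P_cut; have := card_cut_edges e P; lia.
have [/exists_inP[C CF /eqP C3]|] :=
  boolP [exists C in components (remove_edges e F), #|C| == 3].
  by exists C.
rewrite negb_exists_in => /forall_inP no3.
case/and3P: F_cut => _ /forallPn[x /forallPn[y xy]] /forall_inP ge3.
have ge4 z : 3 < #|component (remove_edges e F) z|.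
  have zF : component (remove_edges e F) z \in components (remove_edges e F).
    exact: imset_f.
  by have := ge3 _ zF; have := no3 _ zF; lia.
have F_sym := sym_connect_sym (remove_edges_sym e_sym F).
have disj : [disjoint component (remove_edges e F) x
                    & component (remove_edges e F) y].
  apply/pred0P => z /=; rewrite !inE; apply/negP => /andP[xz yz].
  by case/negP: xy; apply: connect_trans xz _; rewrite F_sym.
(* The component of [y] leaves at least four vertices outside that of [x], so [cut4] contradicts
   [F_le]. *)
have := cut4 (component (remove_edges e F) x) (ge4 x).
have := cut_size_component e F x.
have := max_card (mem (component (remove_edges e F) x :|:
                       component (remove_edges e F) y)).
rewrite cardsU (disjoint_setI0 disj) cards0 -/(dcell_order 2 k).
by have := ge4 y; lia.
Qed.
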